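(* For any positive integers $r$ and $k$ and all $0<z<1$, \[ {\rm A}\left(\{1\}_{r-1},k;\frac{1-z}{1+z}\right)=\sum_{j=0}^{k-2}(-1)^{k-j}T(\{1\}_j,r+1)\,{\rm A}(\{1\}_{k-2-j};z)+(-1)^{k-1}\sum_{\substack{a_1+\cdots+a_k=r\\ a_1,\ldots,a_k\ge0}}{\rm A}\left(\{1\}_{a_k};\frac{1-z}{1+z}\right){\rm A}(a_1+1,\ldots,a_{k-1}+1;z). \]
   Context: For an index $(k_1,\ldots,k_r)$ and $z\in[-1,1)$, ${\rm A}(k_1,\ldots,k_r;z)=2^r\sum_{1\le n_1<\cdots<n_r,\ n_i\equiv i \pmod 2}\frac{z^{n_r}}{n_1^{k_1}\cdots n_r^{k_r}}$; ${\rm A}(\emptyset;z)=1$ (so for $k=1$ the last factor is $1$); $\{1\}_j$ denotes $j$ repetitions of $1$. For an admissible index ($k_r\ge2$), $T(k_1,\ldots,k_r)=2^r\sum_{0<m_1<\cdots<m_r,\ m_i\equiv i\pmod 2}\frac{1}{m_1^{k_1}\cdots m_r^{k_r}}$. *)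

(* Defs.v *)
From HB Require Import structures.
From mathcomp Require Import all_boot all_order all_algebra.
From mathcomp Require Import all_classical all_reals all_analysis.

Set Implicit Arguments.
Unset Strict Implicit.
Unset Printing Implicit Defensive.

Import Order.TTheory GRing.Theory Num.Theory.
Import numFieldNormedType.Exports.
Local Open Scope ring_scope.

(* 0 < n_1 < ... < n_r with n_i = i mod 2.  Sequences are numbered from 0 in
   Rocq, so n_(i+1) is [nth 0 n i]. *)
Definition parity_chain (n : seq nat) : bool :=
  path ltn 0%N n &&
  [forall i : 'I_(size n), nth 0%N n i == i.+1 %[mod 2]].

(* The sum over the chains with n_r < N.  For the empty index the only chain
   is [::], whose last element defaults to 0, so that the value is 1. *)
Definition A_trunc (R : realType) (k : seq nat) (z : R) (N : nat) : R :=
  2 ^+ size k *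
  \sum_(n : (size k).-tuple 'I_N | parity_chain (map val n))
     z ^+ last 0%N (map val n)
       / \prod_(i < size k) (val (tnth n i))%:R ^+ nth 0%N k i.

Definition A (R : realType) (k : seq nat) (z : R) : R :=
  limn (A_trunc k z).

Definition T_trunc (R : realType) (k : seq nat) (N : nat) : R :=
  2 ^+ size k *
  \sum_(m : (size k).-tuple 'I_N | parity_chain (map val m))
     (\prod_(i < size k) (val (tnth m i))%:R ^+ nth 0%N k i)^-1.

Definition T (R : realType) (k : seq nat) : R := limn (T_trunc R k).

Lemma A_trunc_nil (R : realType) (z : R) N : A_trunc [::] z N = 1.
Proof.
rewrite /A_trunc expr0 mul1r (bigD1 [tuple]) /=; last first.
  by rewrite /parity_chain /=; apply/forallP => -[].
rewrite expr0 big_ord0 divr1 big1 ?addr0 // => n.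
by case/andP=> _ /eqP[]; exact: tuple0.
Qed.

Lemma A_nil (R : realType) (z : R) : A [::] z = 1.
Proof.
rewrite /A (_ : A_trunc [::] z = cst 1) ?lim_cst //.
by apply/funext => N; exact: A_trunc_nil.
Qed.

(* Main.v *)
(* Put w = (1 - z) / (1 + z).  This substitution exchanges the differential forms
   a = dz / z and b = 2 dz / (1 - z^2) up to sign, and A is an iterated integral
   of a and b.  For fixed r, differentiating (-1)^(k-1) times either side of the
   identity gives 2 / (1 - z^2) times the same expression for k - 1, so by
   induction on k the two sides differ by a constant.  As z -> 0+ every term on the
   right vanishes (A({1}_m; w) = (- ln z)^m / m! is beaten by a factor O(z)) except
   that with j = k - 2, so the constant is 0 by the duality
   T({1}_{r-1}, k) = T({1}_{k-2}, r + 1).  The duality is obtained from a sum of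
   products of A(.; z) and A(.; w) which has derivative 0, is symmetric under
   z <-> w, and tends to one side of the duality as z -> 0+; since its terms are
   nonnegative, its constancy also gives the convergence of the series T. *)
Require Import Defs.
From HB Require Import structures.
From mathcomp Require Import all_boot all_order all_algebra.
From mathcomp Require Import all_classical all_reals all_analysis.
From mathcomp Require Import ring lra zify.

Set Implicit Arguments.
Unset Strict Implicit.
Unset Printing Implicit Defensive.

Import Order.TTheory GRing.Theory Num.Theory.
Import numFieldNormedType.Exports.
Local Open Scope ring_scope.

(** * Chains and tuples extended at the right end *)

Lemma parity_chain_rcons (s : seq nat) (x : nat) :
  parity_chain (rcons s x) =
  [&& parity_chain s, last 0%N s < x & odd (last 0%N s) != odd x]%N.
Proof.
have parity_chainE t : parity_chain t =
    path ltn 0%N t && all (fun i => nth 0%N t i == i.+1 %[mod 2]) (iota 0 (size t)).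
  rewrite /parity_chain; congr (_ && _); apply/forallP/allP => [h i|h i].
    by rewrite mem_iota /= => lt_it; exact: (h (Ordinal lt_it)).
  by apply: h; rewrite mem_iota /=.
(* Parities alternate, so the last entry alone decides the parity of the next one; the default 0 of
   [last] suits the empty chain. *)
have last_odd t : parity_chain t -> odd (last 0%N t) = odd (size t).
  case: (lastP t) => [//|t' y] /andP[_ /forallP h].
  have lt_size : (size t' < size (rcons t' y))%N by rewrite size_rcons.
  have := h (Ordinal lt_size).
  rewrite /= last_rcons size_rcons nth_rcons ltnn eqxx !modn2 => /eqP.
  by case: (odd y); case: (odd _.+1).
have -> : parity_chain (rcons s x) =
    [&& parity_chain s, last 0%N s < x & x == (size s).+1 %[mod 2]]%N.
  rewrite !parity_chainE size_rcons rcons_path -(addn1 (size s)).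
  rewrite iotaD all_cat /= add0n.
  rewrite nth_rcons ltnn eqxx !andbT.
  rewrite (@eq_in_all _ _ (fun i => nth 0%N s i == i.+1 %[mod 2])); last first.
    by move=> i; rewrite mem_iota /= add0n => lt_is; rewrite nth_rcons lt_is.
  by rewrite addn1 -!andbA; congr (_ && _); exact: andbCA.
case: (boolP (parity_chain s)) => //= /last_odd ->; congr (_ && _).
by rewrite !modn2 /=; case: (odd x); case: (odd _).
Qed.

Lemma big_tuple_rcons (R : nmodType) (I : finType) (n : nat)
    (P : pred (seq I)) (F : seq I -> R) :
  \sum_(t : n.+1.-tuple I | P t) F t =
  \sum_(x : I) \sum_(t : n.-tuple I | P (rcons t x)) F (rcons t x).
Proof.
rewrite pair_big_dep /=.
pose h (p : I * n.-tuple I) : n.+1.-tuple I := [tuple of rcons p.2 p.1].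
rewrite (reindex h) //=.
pose g (t : n.+1.-tuple I) : I * n.-tuple I :=
  (last (thead t) t, [tuple of belast (thead t) (behead t)]).
exists g => [[x t]|t] _.
  rewrite /g /h /=; congr pair; first by rewrite last_rcons.
  apply: val_inj => /=; rewrite /thead (tnth_nth x) /=.
  case: t => -[|y t] //= _.
  by rewrite belast_rcons.
apply: val_inj; rewrite /= /thead (tnth_nth (thead t)).
by case: t => -[|y t] //= _; rewrite -lastI.
Qed.

(** * Taylor coefficients of [A] *)

Section Coefficients.
Variable R : realType.

(* [coef s] are the Taylor coefficients of [A (rev s)]: the head of [s] is the
   exponent of the largest summation variable.  The head may be 0, in which
   case the series is the image of that with head 1 under [x d/dx]. *)
Fixpoint coef (s : seq nat) (n : nat) : R :=
  if s is k :: s' then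
    2 * n%:R ^- k * \sum_(m < n | odd m != odd n) coef s' m
  else (n == 0%N)%:R.

Lemma coef_ge0 s n : 0 <= coef s n.
Proof.
elim: s n => [|k s IHs] n /=; first exact: ler0n.
by rewrite !mulr_ge0 ?invr_ge0 ?exprn_ge0 ?ler0n ?sumr_ge0.
Qed.

Lemma coef0 k s : coef (k :: s) 0 = 0.
Proof. by rewrite /= big_ord0 mulr0. Qed.

(** Induction on the index from the right: removing the largest entry m leaves a chain whose last
    entry is smaller and of the other parity, which is the recursion of [coef]. *)
Lemma sum_chainsE (k : seq nat) (N m : nat) : (m < N)%N ->
  2 ^+ size k * \sum_(t : (size k).-tuple 'I_N |
      parity_chain (map val t) && (last 0%N (map val t) == m))
    (\prod_(i < size k) (nth 0%N (map val t) i)%:R ^+ nth 0%N k i)^-1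
  = coef (rev k) m :> R.
Proof.
elim/last_ind: k m => [|k a IHk] m ltmN.
  rewrite expr0 mul1r /=; case: m ltmN => [|m] ltmN /=.
    rewrite (bigD1 [tuple]) /=; last first.
      by rewrite andbT /parity_chain /=; apply/forallP => -[].
    rewrite big_ord0 invr1 big1 ?addr0 // => n.
    by case/andP=> _ /eqP[]; exact: tuple0.
  by rewrite big_pred0 // => t; rewrite (tuple0 t) andbF.
rewrite rev_rcons size_rcons.
pose w s r : R := (\prod_(i < r) (nth 0%N s i)%:R ^+ nth 0%N (rcons k a) i)^-1.
rewrite (@big_tuple_rcons _ _ _
  (fun t => parity_chain (map val t) && (last 0%N (map val t) == m))
  (fun t => w (map val t) (size k).+1)).
rewrite (bigD1 (Ordinal ltmN)) //= [X in _ + X]big1 ?addr0; last first.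
  move=> i nim; apply: big1 => t; rewrite map_rcons last_rcons => /andP[_ /eqP im].
  by case/eqP: nim; apply: val_inj.
transitivity (2 ^+ (size k).+1 * \sum_(j < m | odd j != odd m)
  \sum_(t : (size k).-tuple 'I_N | parity_chain (map val t)
     && (last 0%N (map val t) == j)) (w (map val t) (size k) / m%:R ^+ a)).
  congr (_ * _); rewrite (exchange_big_dep (fun t : (size k).-tuple 'I_N =>
    parity_chain (map val (rcons t (Ordinal ltmN))))) /=; last first.
    move=> j t oddj /andP[ct /eqP lastj].
    by rewrite map_rcons parity_chain_rcons ct lastj ltn_ord.
  apply: eq_big => [t|t].
    by rewrite map_rcons last_rcons eqxx andbT.
  rewrite map_rcons last_rcons eqxx andbT parity_chain_rcons.
  move=> /and3P[-> lt_last odd_last] /=.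
  rewrite (big_pred1 (Ordinal lt_last)) /=; last first.
    move=> j /=; apply/andP/eqP => [[_ /eqP lastj]|->].
      by apply: val_inj; rewrite /= lastj.
    by rewrite /= eqxx odd_last.
  rewrite /w big_ord_recr /= invfM.
  rewrite !nth_rcons !size_map !size_tuple ltnn eqxx; congr (_^-1 / _).
  by apply: eq_bigr => i _; rewrite !nth_rcons size_map size_tuple ltn_ord.
rewrite /= exprS -!mulrA; congr (2 * _).
rewrite mulr_sumr [RHS]mulr_sumr; apply: eq_bigr => j _.
rewrite -IHk; last by rewrite (ltn_trans _ ltmN).
rewrite [RHS]mulrCA; congr (_ * _).
rewrite mulr_sumr; apply: eq_bigr => t _; rewrite mulrC; congr (_ * _).
by rewrite /w; congr (_^-1); apply: eq_bigr => i _; rewrite nth_rcons ltn_ord.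
Qed.

(** Chains are grouped by their last entry, the exponent of z. The bound is [N.+1] because at 0 the
    empty index would give 1 against an empty partial sum. *)
Lemma A_truncE (k : seq nat) (z : R) (N : nat) :
  A_trunc k z N.+1 = pseries (coef (rev k)) z N.+1.
Proof.
rewrite /A_trunc /pseries /series /= big_mkord mulr_sumr.
under [RHS]eq_bigr => n _ do rewrite -(sum_chainsE _ (ltn_ord n)).
under [RHS]eq_bigr => n _ do rewrite mulr_sumr mulr_suml.
rewrite (exchange_big_dep (fun t : (size k).-tuple 'I_N.+1 =>
  parity_chain (map val t))) /=.
  apply: eq_bigr => t ct; rewrite ct /=.
  have lt_last : (last 0%N (map val t) < N.+1)%N.
    have : all (fun i => i < N.+1)%N (map val t).
      by rewrite all_map; apply/allP => i _ /=.
    by case: (lastP (map val t)) => // s x; rewrite last_rcons all_rcons => /andP[].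
  rewrite (big_pred1 (Ordinal lt_last)); last by move=> j; exact: (eq_sym _ (val j)).
  rewrite /= -mulrA; congr (_ * _); rewrite mulrC; congr (_^-1 * _).
  apply: eq_bigr => i _; rewrite (tnth_nth (Ordinal lt_last)).
  by rewrite (nth_map (Ordinal lt_last)) ?size_tuple.
by move=> n t _ /andP[].
Qed.

Lemma T_truncE (k : seq nat) : T_trunc R k = A_trunc k 1.
Proof.
apply/funext => N; rewrite /T_trunc /A_trunc; congr (_ * _).
by apply: eq_bigr => t _; rewrite expr1n mul1r.
Qed.

End Coefficients.

(** * Power series on (-1, 1) and the derivatives of [A] *)

Section PowerSeries.
Variable R : realType.
Implicit Types (c : nat -> R) (s : seq nat) (x y z : R).

Lemma natr_exp_bounded x : 0 < x -> x < 1 -> exists B, forall n, n%:R * x ^+ n <= B.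
Proof.
move=> x0 x1; exists (1 - x)^-1 => n.
(* This is n x^n <= 1 + x + ... + x^(n-1), multiplied by 1 - x. *)
have h : n%:R * x ^+ n * (1 - x) + x ^+ n <= 1.
  elim: n => [|n IHn]; first by rewrite mul0r mul0r add0r expr0.
  rewrite -natr1 exprS.
  have xn1 : x * x ^+ n <= 1 by rewrite -exprS exprn_ile1 // ltW.
  have := ler_wpM2l (ltW x0) IHn.
  have : (1 - x) * (x * x ^+ n) <= (1 - x) * 1 by rewrite ler_wpM2l // subr_ge0 ltW.
  lra.
rewrite -[_^-1]mul1r ler_pdivlMr ?subr_gt0 //.
by apply: le_trans h; rewrite lerDl exprn_ge0 // ltW.
Qed.

(** Amounts to a radius of convergence of at least 1; bounded terms are easier to carry through the
    operations below than convergence. *)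
Definition subexponential c :=
  forall x, 0 < x -> x < 1 -> exists B, forall n, `|c n| * x ^+ n <= B.

Lemma subexponential_natM c : subexponential c -> subexponential (fun n => n%:R * c n).
Proof.
(* The midpoint of x and 1 leaves room for the factor n: both [c n] y^n and n (x / y)^n are
   bounded. *)
move=> hc x x0 x1; pose y := (1 + x) / 2.
have [y0 y1 xy] : [/\ 0 < y, y < 1 & x < y] by rewrite /y; split; lra.
have [B1 h1] := hc y y0 y1.
have [||B2 h2] := @natr_exp_bounded (x / y); first by rewrite divr_gt0.
  by rewrite ltr_pdivrMr // mul1r.
exists (B1 * B2) => n; rewrite normrM normr_nat.
have -> : x ^+ n = y ^+ n * (x / y) ^+ n by rewrite -exprMn mulrC divfK // gt_eqF.
have -> : n%:R * `|c n| * (y ^+ n * (x / y) ^+ n) =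
    (`|c n| * y ^+ n) * (n%:R * (x / y) ^+ n) by ring.
have xy0 : 0 < x / y by rewrite divr_gt0.
by apply: ler_pM => //; rewrite mulr_ge0 // exprn_ge0 // ltW.
Qed.

Lemma subexponential_le c c' : (forall n, `|c' n| <= `|c n|) ->
  subexponential c -> subexponential c'.
Proof.
move=> le_c hc x x0 x1; have [B hB] := hc x x0 x1; exists B => n.
by apply: le_trans (hB n); rewrite ler_wpM2r // exprn_ge0 // ltW.
Qed.

Lemma subexponential_diffs c : subexponential c -> subexponential (pseries_diffs c).
Proof.
move=> /subexponential_natM hc x x0 x1; have [B hB] := hc x x0 x1.
exists (B / x) => n; rewrite ler_pdivlMr //.
by rewrite -mulrA -exprSr; exact: hB n.+1.
Qed.

Lemma subexponential_sum c (p : nat -> pred nat) : subexponential c ->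
  subexponential (fun n => \sum_(m < n | p n m) c m).
Proof.
move=> hc.
(* The sum is at most n times the largest absolute value, and this maximum obeys the same bound as
   [c] because x^n <= x^m for m < n. *)
suff h : subexponential (fun n => n%:R * \big[Num.max/0]_(m < n) `|c m|).
  apply: subexponential_le h => n.
  rewrite [leRHS]ger0_norm ?mulr_ge0 ?ler0n ?bigmax_ge_id //.
  apply: le_trans (ler_norm_sum _ _ _) _.
  rewrite big_mkcond /= mulr_natl -[X in _ *+ X]card_ord -sumr_const.
  apply: ler_sum => i _; case: ifP => _; last exact: bigmax_ge_id.
  exact: (le_bigmax _ (fun i : 'I_n => `|c i|)).
apply: subexponential_natM => x x0 x1; have [B hB] := hc x x0 x1.
exists B => n; have B0 : 0 <= B by apply: le_trans (hB 0%N); rewrite mulr_ge0.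
rewrite ger0_norm ?bigmax_ge_id // -ler_pdivlMr ?exprn_gt0 //.
apply: bigmax_le => [|i _]; first by rewrite divr_ge0 // exprn_ge0 // ltW.
rewrite ler_pdivlMr ?exprn_gt0 //; apply: le_trans (hB i).
by rewrite ler_wpM2l //; apply: ler_wiXn2l; [exact: ltW|exact: ltW|exact: ltnW].
Qed.

Lemma subexponential_cvg c x : subexponential c -> `|x| < 1 -> cvgn (pseries c x).
Proof.
move=> hc x1; pose y := (1 + `|x|) / 2.
have x0 : 0 <= `|x| by [].
have [y0 y1 xy] : [/\ 0 < y, y < 1 & `|x| < y] by rewrite /y; split; lra.
have [B hB] := hc y y0 y1.
apply: normed_cvg; apply: (@series_le_cvg _ _ (geometric B (`|x| / y))).
- by move=> n; exact: normr_ge0.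
- have B0 : 0 <= B by apply: le_trans (hB 0%N); rewrite mulr_ge0.
  by move=> n /=; rewrite mulr_ge0 // exprn_ge0 // divr_ge0 // ltW.
- move=> n /=; rewrite normrM normrX.
  rewrite expr_div_n mulrA ler_pdivlMr ?exprn_gt0 // mulrAC.
  by rewrite ler_wpM2r ?exprn_ge0.
- apply: is_cvg_geometric_series.
  by rewrite ger0_norm ?ltr_pdivrMr ?mul1r ?divr_ge0 // ltW.
Qed.

Lemma subexponential_is_derive c x : subexponential c -> `|x| < 1 ->
  is_derive x 1 (fun x => limn (pseries c x)) (limn (pseries (pseries_diffs c) x)).
Proof.
move=> hc x1; have x0 : 0 <= `|x| by [].
have y0 : 0 < (1 + `|x|) / 2 by lra.
have y1 : `|(1 + `|x|) / 2| < 1 by rewrite gtr0_norm //; lra.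
apply: (@pseries_snd_diffs _ _ ((1 + `|x|) / 2)).
- exact: subexponential_cvg.
- by apply: subexponential_cvg => //; exact: subexponential_diffs.
- by apply: subexponential_cvg => //; do 2!apply: subexponential_diffs.
- by rewrite [ltRHS]gtr0_norm //; lra.
Qed.

Lemma subexponential_coef s : subexponential (coef R s).
Proof.
elim: s => [|k s IHs] /=.
  move=> x x0 x1; exists 1 => -[|n] /=; first by rewrite normr1 mul1r expr0.
  by rewrite normr0 mul0r.
have := @subexponential_sum _ (fun n m => odd m != odd n) IHs.
move=> h x x0 x1; have [B hB] := h x x0 x1; exists (2 * B) => n.
rewrite !normrM -!mulrA gtr0_norm // ler_pM2l //.
apply: le_trans (hB n); rewrite ler_piMl ?mulr_ge0 // ?exprn_ge0 ?(ltW x0) //.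
rewrite ger0_norm ?invr_ge0 ?exprn_ge0 //.
(* At n = 0 the factor is 1 when k = 0 and otherwise the inverse of 0, which is 0 by convention; it
   is at most 1 either way. *)
case: n => [|n]; first by case: k => [|k]; rewrite ?expr0 ?invr1 // expr0n invr0.
by rewrite invf_le1 ?exprn_gt0 // exprn_ege1 // ler1n.
Qed.

Definition Aser s x : R := limn (pseries (coef R s) x).

Lemma is_cvg_Aser s x : `|x| < 1 -> cvgn (pseries (coef R s) x).
Proof. by move=> x1; apply: subexponential_cvg => //; exact: subexponential_coef. Qed.

Lemma A_rev s x : cvgn (pseries (coef R s) x) ->
  A (rev s) x = limn (pseries (coef R s) x).
Proof.
move=> cv; apply/cvg_lim => //; rewrite -cvg_shiftS /=.
under eq_cvg do rewrite A_truncE revK.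
have : ((fun N => pseries (coef R s) x N.+1) @ \oo -->
    limn (pseries (coef R s) x))%classic.
  by rewrite cvg_shiftS.
exact.
Qed.

Lemma pseriesE c x N : pseries c x N = \sum_(0 <= i < N) c i * x ^+ i.
Proof. by []. Qed.

Lemma pseries_recl c x N :
  pseries c x N.+1 = c 0%N + x * pseries (fun n => c n.+1) x N.
Proof.
rewrite /pseries /series /= big_nat_recl // expr0 mulr1; congr (_ + _).
by rewrite mulr_sumr; apply: eq_bigr => i _; rewrite exprS mulrCA.
Qed.

Lemma pseries_coefS k s x N :
  x * pseries (pseries_diffs (coef R (k.+1 :: s))) x N =
  pseries (coef R (k :: s)) x N.+1.
Proof.
rewrite pseries_recl coef0 add0r; congr (_ * pseries _ _ _); apply/funext => n.
rewrite /pseries_diffs /= !mulrA; congr (_ * _).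
by rewrite [_ * 2]mulrC -mulrA exprS invfM mulVKf ?pnatr_eq0.
Qed.

Lemma is_derive_AserS k s x : x != 0 -> `|x| < 1 ->
  is_derive x 1 (Aser (k.+1 :: s)) (x^-1 * Aser (k :: s) x).
Proof.
move=> x0 x1; have sc := @subexponential_coef (k.+1 :: s).
apply: is_derive_eq (subexponential_is_derive sc x1) _.
apply: (mulfI x0); rewrite mulrA divff // mul1r /Aser.
have cv := subexponential_cvg (subexponential_diffs sc) x1.
apply/esym/cvg_lim => //; rewrite -cvg_shiftS /=.
under eq_cvg do rewrite -pseries_coefS.
exact: cvgMl_tmp.
Qed.

Lemma coef_head0 s n : coef R (0%N :: s) n.+2 = coef R (0%N :: s) n + 2 * coef R s n.+1.
Proof.
rewrite /= !expr0 !invr1 !mulr1 -mulrDr; congr (2 * _).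
rewrite negbK [in LHS]big_mkcond [in RHS]big_mkcond 2!big_ord_recr /= eqxx addr0.
by case: (odd n).
Qed.

(** Multiplying a series by 2x / (1 - x^2) = 2 (x + x^3 + ...) sums its coefficients over the
    smaller indices of opposite parity, which is what a head exponent 0 does; [coef_head0] is this
    fact cleared of the denominator. *)
Lemma Aser_head0 s x : `|x| < 1 ->
  (1 - x ^+ 2) * Aser (0%N :: s) x = 2 * x * Aser s x.
Proof.
move=> x1.
suff : Aser (0%N :: s) x = x ^+ 2 * Aser (0%N :: s) x + 2 * x * Aser s x.
  by move=> h; lra.
apply/cvg_lim => //; rewrite -2!cvg_shiftS /=.
have E N : pseries (coef R (0%N :: s)) x N.+2 =
    x ^+ 2 * pseries (coef R (0%N :: s)) x N + 2 * x * pseries (coef R s) x N.+1.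
  rewrite 2!pseries_recl coef0 add0r [in RHS]pseries_recl.
  have -> : coef R (0%N :: s) 1 = 2 * coef R s 0.
    by rewrite /= big_mkcond big_ord1 /= expr0 invr1 mulr1.
  have -> : (fun n => coef R (0%N :: s) n.+2) =
      (fun n => coef R (0%N :: s) n + 2 * coef R s n.+1).
    by apply/funext => n; rewrite coef_head0.
  have -> : pseries (fun n => coef R (0%N :: s) n + 2 * coef R s n.+1) x N =
      pseries (coef R (0%N :: s)) x N + 2 * pseries (fun n => coef R s n.+1) x N.
    rewrite /pseries /series /= mulr_sumr -big_split /=.
    by apply: eq_bigr => i _; rewrite mulrDl mulrA.
  ring.
under eq_cvg do rewrite E.
apply: cvgD; apply: cvgMl_tmp; first exact: is_cvg_Aser.
by rewrite (cvg_shiftS (pseries (coef R s) x)); exact: is_cvg_Aser.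
Qed.

(** [is_derive_AserS] leaves head exponent 0, which [Aser_head0] trades for the form b. *)
Lemma is_derive_Aser1 s x : x != 0 -> `|x| < 1 ->
  is_derive x 1 (Aser (1%N :: s)) (2 / (1 - x ^+ 2) * Aser s x).
Proof.
move=> x0 x1; apply: is_derive_eq (is_derive_AserS _ _ x0 x1) _.
have x2 : 1 - x ^+ 2 != 0.
  by rewrite subr_eq0 gt_eqF // -real_normK ?num_real // expr_lt1.
apply: (mulfI x2); rewrite mulrCA Aser_head0 //.
by field; rewrite x0 x2.
Qed.

Lemma pseries_coef_ge0 s x N : 0 <= x -> 0 <= pseries (coef R s) x N.
Proof.
by move=> x0; apply: sumr_ge0 => i _; rewrite mulr_ge0 ?coef_ge0 ?exprn_ge0.
Qed.

Lemma Aser_ge_pseries s x N : 0 <= x -> x < 1 -> pseries (coef R s) x N <= Aser s x.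
Proof.
move=> x0 x1; apply: (@nondecreasing_cvgn_le _ (pseries (coef R s) x)).
  by apply: nondecreasing_series => i _ _; rewrite mulr_ge0 ?coef_ge0 ?exprn_ge0.
by apply: is_cvg_Aser; rewrite ger0_norm.
Qed.

Lemma Aser_ge0 s x : 0 <= x -> x < 1 -> 0 <= Aser s x.
Proof.
by move=> x0 x1; apply: le_trans (Aser_ge_pseries s 0 x0 x1); exact: pseries_coef_ge0.
Qed.

Lemma Aser_le s x b : 0 <= x -> x < 1 ->
  (forall N, pseries (coef R s) x N <= b) -> Aser s x <= b.
Proof.
move=> x0 x1 h; apply: limr_le; last exact: nearW.
by apply: is_cvg_Aser; rewrite ger0_norm.
Qed.

(** There is no constant term, and x^i <= x (1/2)^(i-1) for i >= 1; the missing factor 1/2 accounts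
    for the 2. *)
Lemma Aser_le_linear k s x : 0 <= x -> x <= 2^-1 ->
  Aser (k :: s) x <= x * (2 * Aser (k :: s) 2^-1).
Proof.
move=> x0 x1; apply: Aser_le => // [|N]; first lra.
apply: le_trans (_ : x * (2 * pseries (coef R (k :: s)) 2^-1 N) <= _); last first.
  by rewrite ler_wpM2l // ler_wpM2l // Aser_ge_pseries //; lra.
rewrite !pseriesE mulrA mulr_sumr; apply: ler_sum => i _.
case: i => [|i]; first by rewrite coef0 !mul0r mulr0.
rewrite mulrCA ler_wpM2l ?coef_ge0 // !exprS.
rewrite -!mulrA ler_wpM2l // mulrA divff // mul1r lerXn2r // nnegrE; lra.
Qed.

End PowerSeries.

(** * Derivatives and limits of finite sums; functions with derivative 0 *)

Section Calculus.
Variable R : realType.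
Local Open Scope classical_set_scope.
Local Open Scope ring_scope.
Implicit Types (f g : R -> R) (x y z l : R).

Lemma is_derive_prod f g x df dg : is_derive x 1 f df -> is_derive x 1 g dg ->
  is_derive x 1 (fun y => f y * g y) (df * g x + f x * dg).
Proof.
move=> hf hg; apply: is_derive_eq (is_deriveM hf hg) _.
by rewrite addrC [g x *: _]mulrC.
Qed.

Lemma is_derive_bigsum (I : Type) (r : seq I) (P : pred I) (h : I -> R -> R)
    (dh : I -> R) x : (forall i, P i -> is_derive x 1 (h i) (dh i)) ->
  is_derive x 1 (fun y => \sum_(i <- r | P i) h i y) (\sum_(i <- r | P i) dh i).
Proof.
move=> hh; elim: r => [|i r IHr].
  under eq_fun do rewrite big_nil.
  by rewrite big_nil; exact: is_derive_cst.
under eq_fun do rewrite big_cons.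
rewrite big_cons; case: ifP => // Pi; exact: is_deriveD (hh i Pi) IHr.
Qed.

Lemma cvg_bigsum (I : Type) (r : seq I) (P : pred I) (h : I -> R -> R)
    (a : I -> R) (F : set_system R) : Filter F ->
  (forall i, P i -> h i x @[x --> F] --> a i) ->
  \sum_(i <- r | P i) h i x @[x --> F] --> \sum_(i <- r | P i) a i.
Proof.
move=> FF hh; elim: r => [|i r IHr].
  under eq_fun do rewrite big_nil.
  by rewrite big_nil; exact: cvg_cst.
under eq_fun do rewrite big_cons.
by rewrite big_cons; case: ifP => // Pi; apply: cvgD => //; exact: hh.
Qed.

Lemma cvg_bigsum0 (I : Type) (r : seq I) (P : pred I) (h : I -> R -> R)
    (F : set_system R) : Filter F ->
  (forall i, P i -> h i x @[x --> F] --> 0) ->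
  \sum_(i <- r | P i) h i x @[x --> F] --> 0.
Proof.
move=> FF hh; have := @cvg_bigsum I r P h (fun=> 0) F FF hh.
by rewrite big1_eq.
Qed.

Lemma cvg_exprn (f : R -> R) l n (F : set_system R) : Filter F ->
  f x @[x --> F] --> l -> f x ^+ n @[x --> F] --> l ^+ n.
Proof.
move=> FF fl; elim: n => [|n IHn].
  by under eq_cvg do rewrite expr0; rewrite expr0; exact: cvg_cst.
by under eq_cvg do rewrite exprS; rewrite exprS; exact: cvgM.
Qed.

Lemma is_derive_exprn f x df n : is_derive x 1 f df ->
  is_derive x 1 (fun y => f y ^+ n) (n%:R * f x ^+ n.-1 * df).
Proof.
move=> hf; have -> : (fun y => f y ^+ n) = f ^+ n.
  by apply/funext => y; rewrite exprfctE.
exact: is_deriveX.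
Qed.

Lemma derive0_cst01 f : (forall x, 0 < x -> x < 1 -> is_derive x 1 f 0) ->
  forall x y, 0 < x -> x < 1 -> 0 < y -> y < 1 -> f x = f y.
Proof.
move=> df x y; wlog xy : x y / x <= y => [H|] x0 x1 y0 y1.
  by case: (leP x y) => [/H|/ltW /H] h; [exact: h|apply/esym; exact: h].
have in01 t : t \in `[x, y] -> 0 < t /\ t < 1.
  by rewrite in_itv /= => /andP[xt ty]; split; [exact: lt_le_trans xt|exact: le_lt_trans y1].
have [t tin||c cin] := @MVT_segment R f (cst 0) x y xy.
- have /in01[t0 t1] : t \in `[x, y] by apply: subset_itv_oo_cc.
  exact: df.
- apply: derivable_within_continuous => t /in01[t0 t1].
  by have := df t t0 t1; case.
- by rewrite mul0r => /eqP; rewrite subr_eq0 => /eqP.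
Qed.

Lemma derive0_limit01 f l : (forall x, 0 < x -> x < 1 -> is_derive x 1 f 0) ->
  f x @[x --> 0^'+] --> l -> forall x, 0 < x -> x < 1 -> f x = l.
Proof.
move=> df fl x x0 x1.
apply: (@cvg_unique _ _ (f @ 0^'+)) => //.
apply: cvg_near_cst; near=> y; apply: (derive0_cst01 df) => //.
Unshelve. all: by end_near. Qed.

(* [l i] and [v j] stand for iterated integrals from the two ends of a path to a
   moving point, hence the opposite signs; the sum of their derivatives telescopes. *)
Lemma is_derive_composition (l v : nat -> R -> R) (t z : R) (p : nat) :
  is_derive z 1 (l 0%N) 0 ->
  (forall i, is_derive z 1 (l i.+1) (t * l i z)) ->
  (forall j, is_derive z 1 (v j.+1) (- t * v j z)) ->
  is_derive z 1 (fun x => \sum_(i < p.+1) l i x * v (p - i).+1 x)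
    (- t * (l p z * v 0%N z)).
Proof.
move=> l0 lS vS.
pose dl i := if i is i'.+1 then t * l i' z else 0.
have hl i : is_derive z 1 (l i) (dl i) by case: i.
apply: is_derive_eq (is_derive_bigsum _ (fun (i : 'I_p.+1) _ =>
  is_derive_prod (hl i) (vS (p - i)%N))) _.
rewrite big_split /= big_ord_recl big_ord_recr /= mul0r add0r subnn.
rewrite addrA -big_split /= big1 ?add0r; first by ring.
move=> i _; rewrite /bump /= add1n (_ : p - i = (p - i.+1).+1)%N; last by rewrite subnSK.
by ring.
Qed.

End Calculus.

(** * The substitution z -> (1 - z) / (1 + z) and the behaviour as z -> 0+ *)

Section Cayley.
Variable R : realType.
Local Open Scope classical_set_scope.
Local Open Scope ring_scope.
Implicit Types (x y z : R) (s : seq nat).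

Definition cayley z := (1 - z) / (1 + z).

Lemma cayley_gt0 z : 0 < z -> z < 1 -> 0 < cayley z.
Proof. by move=> z0 z1; rewrite divr_gt0 //; lra. Qed.

Lemma cayley_lt1 z : 0 < z -> z < 1 -> cayley z < 1.
Proof. by move=> z0 z1; rewrite ltr_pdivrMr; lra. Qed.

Lemma cayley_norm_lt1 z : 0 < z -> z < 1 -> `|cayley z| < 1.
Proof. by move=> z0 z1; rewrite gtr0_norm ?cayley_gt0 ?cayley_lt1. Qed.

Lemma cayleyK z : 0 < z -> cayley (cayley z) = z.
Proof.
by move=> z0; rewrite /cayley; field; rewrite !gt_eqF //; lra.
Qed.

Lemma is_derive_cayley z : 0 < z -> is_derive z 1 cayley (- 2 / (1 + z) ^+ 2).
Proof.
move=> z0; have z1 : 1 + z != 0 by rewrite gt_eqF //; lra.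
have d1 : is_derive z 1 (fun y : R => 1 - y) (-1).
  have h := is_deriveB (is_derive_cst (1 : R^o) z 1) (is_derive_id z 1).
  by apply: is_derive_eq h _; rewrite sub0r.
have d2 : is_derive z 1 (fun y : R => 1 + y) 1.
  have h := is_deriveD (is_derive_cst (1 : R^o) z 1) (is_derive_id z 1).
  by apply: is_derive_eq h _; rewrite add0r.
apply: is_derive_eq (is_derive_prod d1 (is_deriveV z1 d2)) _.
by rewrite /GRing.scale /=; field.
Qed.

Lemma cvg_cayley : cayley z @[z --> 0^'+] --> (1 : R).
Proof.
have -> : (1 : R) = cayley 0 by rewrite /cayley subr0 addr0 divr1.
apply: cvg_at_right_filter; apply: cvgM.
  by apply: cvgB; [exact: cvg_cst|exact: cvg_id].
by apply: cvgV; [rewrite addr0 oner_eq0|apply: cvgD; [exact: cvg_cst|exact: cvg_id]].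
Qed.

Lemma norm_lt1 z : 0 < z -> z < 1 -> `|z| < 1.
Proof. by move=> z0 z1; rewrite gtr0_norm. Qed.

(** With w = [cayley z], 1 - w^2 = 4z / (1 + z)^2, so the form b pulls back to -a;
    [is_derive_AserSS_cayley] is the reverse exchange. *)
Lemma is_derive_Aser1_cayley s z : 0 < z -> z < 1 ->
  is_derive z 1 (fun y => Aser (1%N :: s) (cayley y)) (- z^-1 * Aser s (cayley z)).
Proof.
move=> z0 z1; have w0 := cayley_gt0 z0 z1.
have := is_derive_Aser1 s (lt0r_neq0 w0) (cayley_norm_lt1 z0 z1).
move=> h; apply: is_derive_eq (is_derive1_comp h (is_derive_cayley z0)) _.
rewrite mulrAC; congr (_ * _).
have z2 : 1 + z != 0 by rewrite gt_eqF //; lra.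
have -> : 1 - cayley z ^+ 2 = 4 * z / (1 + z) ^+ 2 by rewrite /cayley; field.
by field; rewrite z2 gt_eqF.
Qed.

Lemma is_derive_AserSS_cayley k s z : 0 < z -> z < 1 ->
  is_derive z 1 (fun y => Aser (k.+1 :: s) (cayley y))
    (- (2 / (1 - z ^+ 2)) * Aser (k :: s) (cayley z)).
Proof.
move=> z0 z1; have w0 := cayley_gt0 z0 z1.
have := is_derive_AserS k s (lt0r_neq0 w0) (cayley_norm_lt1 z0 z1).
move=> h; apply: is_derive_eq (is_derive1_comp h (is_derive_cayley z0)) _.
rewrite mulrAC; congr (_ * _).
rewrite (_ : 1 - z ^+ 2 = (1 - z) * (1 + z)); last by ring.
have [z2 z3] : 1 + z != 0 /\ 1 - z != 0 by split; rewrite gt_eqF //; lra.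
by rewrite /cayley; field; rewrite z2 z3.
Qed.

Lemma Aser_nil x : Aser [::] x = 1.
Proof.
apply/cvg_lim => //; rewrite -cvg_shiftS /=; apply: cvg_near_cst; apply: nearW => N.
rewrite pseriesE big_nat_recl // big1 ?addr0 /= ?expr0 ?mulr1 // => i _.
by rewrite mul0r.
Qed.

Lemma cvg_Aser0 k s : Aser (k :: s) x @[x --> 0^'+] --> (0 : R).
Proof.
apply: (@squeeze_cvgr _ _ _ _ (cst 0) (fun x => x * (2 * Aser (k :: s) 2^-1))).
- near=> x; have x0 : 0 < x by [].
  have x1 : x <= 2^-1 by near: x; apply: nbhs_right_le; lra.
  by rewrite Aser_ge0 ?(ltW x0) ?Aser_le_linear ?ltW //; lra.
- exact: cvg_cst.
- rewrite -[X in _ --> X](mul0r (2 * Aser (k :: s) 2^-1)); apply: cvgM; last exact: cvg_cst.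
  by apply: cvg_at_right_filter; exact: cvg_id.
Unshelve. all: by end_near. Qed.

(** [- ln (cayley x)] is the integral of b from 0 to x. Both sides obey the same recursion of
    derivatives and, for m > 0, vanish at 0+. *)
Lemma Aser_ones x m : 0 < x -> x < 1 ->
  Aser (nseq m 1%N) x = (- ln (cayley x)) ^+ m / m`!%:R.
Proof.
elim: m x => [|m IHm] x x0 x1; first by rewrite Aser_nil expr0 fact0 divr1.
apply/eqP; rewrite -subr_eq0; apply/eqP.
pose f y := Aser (nseq m.+1 1%N) y - (- ln (cayley y)) ^+ m.+1 / m.+1`!%:R.
apply: (@derive0_limit01 _ f 0) => // [y y0 y1|].
  have hl : is_derive y 1 (fun y => - ln (cayley y)) (2 / (1 - y ^+ 2)).
    have h := is_derive1_comp (is_derive1_ln (cayley_gt0 y0 y1)) (is_derive_cayley y0).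
    apply: is_derive_eq (is_deriveN h) _.
    rewrite (_ : 1 - y ^+ 2 = (1 - y) * (1 + y)); last by ring.
    have [y2 y3] : 1 + y != 0 /\ 1 - y != 0 by split; rewrite gt_eqF //; lra.
    by rewrite /cayley; field; rewrite y2 y3.
  have h1 := is_derive_prod (is_derive_exprn m.+1 hl)
    (is_derive_cst (m.+1`!%:R^-1 : R^o) y 1).
  have h2 := is_derive_Aser1 (nseq m 1%N) (lt0r_neq0 y0) (norm_lt1 y0 y1).
  apply: is_derive_eq (is_deriveB h2 h1) _; rewrite IHm // mulr0 addr0.
  apply/eqP; rewrite subr_eq0; apply/eqP.
  rewrite factS natrM invfM /=; have : m.+1%:R != 0 :> R by rewrite pnatr_eq0.
  move: (2 / _) m.+1%:R (_ ^+ m) (m`!%:R^-1) => a b c d b0.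
  by field.
rewrite -[X in _ --> X]subr0; apply: cvgB; first exact: cvg_Aser0.
rewrite -[X in _ --> X](mul0r (m.+1`!%:R^-1)); apply: cvgM; last exact: cvg_cst.
rewrite -[X in _ --> X](expr0n R m.+1); apply: cvg_exprn.
rewrite -[X in _ --> X]oppr0; apply: cvgN; rewrite -[X in _ --> X](@ln1 R).
apply: (@continuous_cvg _ _ _ _ _ _ (@ln R)); last exact: cvg_cayley.
exact: continuous_ln.
Unshelve. all: by end_near. Qed.

Lemma cvg_mul_lnX m : z * (- ln z) ^+ m @[z --> 0^'+] --> (0 : R).
Proof.
(* With t = - ln z, the exponential series gives t^(m+1) / (m+1)! <= e^t = 1/z, hence z t^m <=
   (m+1)! / t. *)
apply: (@squeeze_cvgr _ _ _ _ (cst 0) (fun z => m.+1`!%:R * (- ln z)^-1)).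
- near=> z; have z0 : 0 < z by [].
  have z1 : z < 1 by near: z; exact: nbhs_right_lt.
  have t0 : 0 < - ln z by rewrite oppr_gt0 ln_lt0 // z0.
  rewrite mulr_ge0 ?exprn_ge0 ?(ltW z0) ?(ltW t0) //= ler_pdivlMr //.
  rewrite -mulrA -exprSr.
  have := expR_ge1Dxn m (ltW t0); rewrite expRN lnK ?posrE // => h.
  have : (- ln z) ^+ m.+1 / m.+1`!%:R <= z^-1 by apply: le_trans h; rewrite lerDr.
  by rewrite ler_pdivrMr ?ltr0n ?fact_gt0 // mulrC ler_pdivlMr // mulrC.
- exact: cvg_cst.
- rewrite -[X in _ --> X](mulr0 m.+1`!%:R); apply: cvgM; first exact: cvg_cst.
  apply/gtr0_cvgV0; last first.
    by apply/cvgNry; exact: lnNy.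
  by near=> z; rewrite oppr_gt0 ln_lt0 //; apply/andP; split.
Unshelve. all: by end_near. Qed.

Lemma cvg_Aser_mul_ones k s m :
  Aser (k :: s) z * Aser (nseq m 1%N) (cayley z) @[z --> 0^'+] --> (0 : R).
Proof.
pose C : R := 2 * Aser (k :: s) 2^-1 / m`!%:R.
apply: (@squeeze_cvgr _ _ _ _ (cst 0) (fun z => C * (z * (- ln z) ^+ m))).
- near=> z; have z0 : 0 < z by [].
  have z1 : z <= 2^-1 by near: z; apply: nbhs_right_le; lra.
  have lt_z1 : z < 1 by lra.
  have w0 := cayley_gt0 z0 lt_z1; have w1 := cayley_lt1 z0 lt_z1.
  rewrite mulr_ge0 ?Aser_ge0 ?(ltW z0) ?(ltW w0) //=.
  have -> : C * (z * (- ln z) ^+ m) = (z * (2 * Aser (k :: s) 2^-1)) *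
      Aser (nseq m 1%N) (cayley z).
    by rewrite Aser_ones // cayleyK // /C; ring.
  by apply: ler_wpM2r; [rewrite Aser_ge0 // ltW|rewrite Aser_le_linear // ltW].
- exact: cvg_cst.
- by rewrite -[X in _ --> X](mulr0 C); apply: cvgM; [exact: cvg_cst|exact: cvg_mul_lnX].
Unshelve. all: by end_near. Qed.

Lemma cvg_pseries_cayley (c : nat -> R) N :
  pseries c (cayley z) N @[z --> 0^'+] --> pseries c 1 N.
Proof.
rewrite pseriesE; under eq_cvg do rewrite pseriesE.
apply: cvg_bigsum => i _; apply: cvgM; first exact: cvg_cst.
by apply: cvg_exprn; exact: cvg_cayley.
Qed.

(** * Abel's limit theorem for nonnegative coefficients *)

Section BoundedSeries.
Variables (s : seq nat) (K : R).
Hypothesis Aser_leK : forall x, 0 < x -> x < 1 -> Aser s x <= K.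

Let nondecreasing_pseries1 : nondecreasing_seq (pseries (coef R s) 1).
Proof.
by apply: nondecreasing_series => i _ _; rewrite mulr_ge0 ?coef_ge0 ?exprn_ge0.
Qed.

(** Each partial sum at 1 is the limit of partial sums at [cayley z], which are at most [K]. *)
Lemma is_cvg_pseries1 : cvgn (pseries (coef R s) 1).
Proof.
apply: nondecreasing_is_cvgn => //.
exists K => _ [N _ <-].
apply: (cvgr_to_le (@cvg_pseries_cayley (coef R s) N)); near=> z.
have z0 : 0 < z by [].
have z1 : z < 1 by [].
apply: le_trans (Aser_leK (cayley_gt0 z0 z1) (cayley_lt1 z0 z1)).
by apply: Aser_ge_pseries; [rewrite ltW // cayley_gt0|exact: cayley_lt1].
Unshelve. all: by end_near. Qed.

(** The value at [cayley z] lies between the partial sum there and the full sum at 1; these are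
    close once N is fixed large and z is small. *)
Lemma cvg_Aser_cayley :
  Aser s (cayley z) @[z --> 0^'+] --> limn (pseries (coef R s) 1).
Proof.
apply/cvgrPdist_lt => e e0; have e20 : 0 < e / 2 by rewrite divr_gt0.
have /cvgrPdist_lt/(_ _ e20)[N _ /(_ N (leqnn N)) /= hN] := is_cvg_pseries1.
have /cvgrPdist_lt/(_ _ e20) hz := @cvg_pseries_cayley (coef R s) N.
near=> z.
have z0 : 0 < z by [].
have z1 : z < 1 by [].
have w0 := cayley_gt0 z0 z1; have w1 := cayley_lt1 z0 z1.
have h1 : pseries (coef R s) (cayley z) N <= Aser s (cayley z).
  by apply: Aser_ge_pseries; rewrite // ltW.
have h2 : Aser s (cayley z) <= limn (pseries (coef R s) 1).
  apply: Aser_le; rewrite ?(ltW w0) // => M.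
  apply: le_trans (nondecreasing_cvgn_le nondecreasing_pseries1 is_cvg_pseries1 M).
  rewrite !pseriesE; apply: ler_sum => i _.
  by rewrite ler_wpM2l ?coef_ge0 // expr1n exprn_ile1 // ltW.
have h3 : `|pseries (coef R s) 1 N - pseries (coef R s) (cayley z) N| < e / 2.
  by near: z.
move: hN h3; rewrite !ltr_norml => /andP[_ a1] /andP[_ a2].
by apply/andP; split; lra.
Unshelve. all: by end_near. Qed.

End BoundedSeries.
End Cayley.

(** * Duality of [T] by path composition *)

Section Duality.
Variable R : realType.
Local Open Scope classical_set_scope.
Local Open Scope ring_scope.
Implicit Types (x y z : R) (s : seq nat) (p q : nat).

Lemma A_Aser s x : 0 < x -> x < 1 -> A s x = Aser (rev s) x.
Proof.
by move=> x0 x1; rewrite -{1}[s]revK A_rev //; apply: is_cvg_Aser; exact: norm_lt1.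
Qed.

Lemma is_derive_Aser_nil x : is_derive x 1 (Aser (nseq 0 1%N)) (0 : R).
Proof.
have -> : Aser (nseq 0 1%N) = cst (1 : R^o) by apply/funext => y; exact: Aser_nil.
exact: is_derive_cst.
Qed.

Lemma is_derive_Aser_nil_cayley x :
  is_derive x 1 (fun y => Aser (nseq 0 1%N) (cayley y)) (0 : R).
Proof.
have -> : (fun y => Aser (nseq 0 1%N) (cayley y)) = cst (1 : R^o).
  by apply/funext => y; exact: Aser_nil.
exact: is_derive_cst.
Qed.

(** The splits before the end of the block of letters b: i of the p + 1 lie before the moving point,
    and [cayley] turns the remainder b^(p+1-i) a^(q+1), read backwards, into b^(q+1) a^(p+1-i). *)
Definition path_sum p q x y : R :=
  \sum_(i < p.+1) Aser (nseq i 1%N) x * Aser ((p - i).+2 :: nseq q 1%N) y.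

(* The iterated integral of the word [b^(p+1) a^(q+1)] from 0 to 1, split at [z]
   by path composition; the half from [z] to 1 is pulled back by [cayley]. *)
Definition path_composition p q z : R :=
  path_sum p q z (cayley z) + path_sum q p (cayley z) z
  + Aser (nseq p.+1 1%N) z * Aser (nseq q.+1 1%N) (cayley z).

Lemma path_composition_sym p q z : 0 < z ->
  path_composition p q z = path_composition q p (cayley z).
Proof.
move=> z0; rewrite /path_composition cayleyK // [path_sum p q _ _ + _]addrC.
by congr (_ + _); rewrite mulrC.
Qed.

(** Each path sum telescopes to one boundary term, and the product rule for the last summand yields
    the opposites of both. *)
Lemma is_derive_path_composition p q z : 0 < z -> z < 1 ->
  is_derive z 1 (path_composition p q) 0.
Proof.
move=> z0 z1; have z_neq0 := lt0r_neq0 z0; have nz1 := norm_lt1 z0 z1.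
have d1 := is_derive_composition (l := fun i => Aser (nseq i 1%N))
  (v := fun j y => Aser (j.+1 :: nseq q 1%N) (cayley y)) (t := 2 / (1 - z ^+ 2)) p
  (is_derive_Aser_nil z) (fun i => is_derive_Aser1 (nseq i 1%N) z_neq0 nz1)
  (fun j => is_derive_AserSS_cayley j.+1 (nseq q 1%N) z0 z1).
have d2 := is_derive_composition (l := fun i y => Aser (nseq i 1%N) (cayley y))
  (v := fun j => Aser (j.+1 :: nseq p 1%N)) (t := - z^-1) q
  (is_derive_Aser_nil_cayley z)
  (fun i => is_derive_Aser1_cayley (nseq i 1%N) z0 z1).
have {}d2 := d2 _; rewrite opprK in d2.
have {}d2 := d2 (fun j => is_derive_AserS j.+1 (nseq p 1%N) z_neq0 nz1).
have d3 := is_derive_prod (is_derive_Aser1 (nseq p 1%N) z_neq0 nz1)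
  (is_derive_Aser1_cayley (nseq q 1%N) z0 z1).
apply: is_derive_eq (is_deriveD (is_deriveD d1 d2) d3) _.
rewrite /=; ring.
Qed.

Lemma path_sum_ge0 p q x y : 0 < x -> x < 1 -> 0 < y -> y < 1 -> 0 <= path_sum p q x y.
Proof.
by move=> x0 x1 y0 y1; apply: sumr_ge0 => i _; rewrite mulr_ge0 ?Aser_ge0 // ltW.
Qed.

(** [path_composition] is constant. Evaluated at [cayley x], it has the left side as a term, namely
    i = 0 in its first path sum, and its other terms are nonnegative. *)
Lemma Aser_le_path_composition p q x : 0 < x -> x < 1 ->
  Aser (p.+2 :: nseq q 1%N) x <= path_composition p q 2^-1.
Proof.
move=> x0 x1; have w0 := cayley_gt0 x0 x1; have w1 := cayley_lt1 x0 x1.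
have h0 : 0 < (2^-1 : R) by lra.
have h1 : 2^-1 < 1 :> R by lra.
rewrite (derive0_cst01 (@is_derive_path_composition p q) h0 h1 w0 w1).
rewrite path_composition_sym // /path_composition cayleyK // [path_sum q p _ _ + _]addrC.
rewrite -addrA {1}/path_sum big_ord_recl Aser_nil mul1r subn0 -addrA lerDl.
rewrite addr_ge0 //; first by apply: sumr_ge0 => i _; rewrite mulr_ge0 ?Aser_ge0 ?ltW.
by rewrite addr_ge0 ?path_sum_ge0 // mulr_ge0 ?Aser_ge0 ?ltW.
Qed.

Lemma is_cvg_coef1 p q : cvgn (pseries (coef R (p.+2 :: nseq q 1%N)) 1).
Proof. exact: is_cvg_pseries1 (@Aser_le_path_composition p q). Qed.

Lemma T_ones p q :
  T R (rcons (nseq q 1%N) p.+2) = limn (pseries (coef R (p.+2 :: nseq q 1%N)) 1).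
Proof.
rewrite /T T_truncE -(@A_rev _ (p.+2 :: nseq q 1%N) 1); last exact: is_cvg_coef1.
by rewrite /A rev_cons rev_nseq.
Qed.

Lemma cvg_Aser_T p q :
  Aser (p.+2 :: nseq q 1%N) (cayley z) @[z --> 0^'+] --> T R (rcons (nseq q 1%N) p.+2).
Proof. by rewrite T_ones; exact: cvg_Aser_cayley (@Aser_le_path_composition p q). Qed.

(** As z -> 0+ only i = 0 in the first path sum survives: its other terms pair a factor tending to 0
    with a convergent one, and all the rest pair a factor O(z) with a power of ln z. *)
Lemma path_composition_T p q z : 0 < z -> z < 1 ->
  path_composition p q z = T R (rcons (nseq q 1%N) p.+2).
Proof.
apply: derive0_limit01; first exact: is_derive_path_composition.
rewrite -[X in _ --> X]addr0; apply: cvgD; last exact: cvg_Aser_mul_ones.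
rewrite -[X in _ --> X]addr0; apply: cvgD.
  rewrite -[X in _ --> X]addr0.
  under eq_cvg do rewrite /path_sum big_ord_recl Aser_nil mul1r subn0.
  apply: cvgD; first exact: cvg_Aser_T.
  apply: cvg_bigsum0 => i _.
  rewrite -[X in _ --> X](mul0r (T R (rcons (nseq q 1%N) (p - bump 0 i).+2))).
  by apply: cvgM; [exact: cvg_Aser0|exact: cvg_Aser_T].
apply: cvg_bigsum0 => i _; under eq_cvg do rewrite mulrC.
exact: cvg_Aser_mul_ones.
Qed.

Lemma T_duality p q : T R (rcons (nseq q 1%N) p.+2) = T R (rcons (nseq p 1%N) q.+2).
Proof.
have h0 : 0 < (2^-1 : R) by lra.
have h1 : 2^-1 < 1 :> R by lra.
rewrite -(path_composition_T p q h0 h1) path_composition_sym // path_composition_T //.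
  exact: cayley_gt0.
exact: cayley_lt1.
Qed.

End Duality.

(** * Sums over compositions into nonnegative parts *)

Section Compositions.
Variables (R : realType) (r : nat).
Local Open Scope classical_set_scope.
Local Open Scope ring_scope.
Implicit Types (x z : R) (m n j : nat).

(** Parts are taken in ['I_r.+1] to keep the sum finite; for n <= r this loses no composition. *)
Definition comp_sum m n x : R :=
  \sum_(t : m.-tuple 'I_r.+1 | sumn (map val t) == n)
    Aser (rev [seq i.+1 | i <- map val t]) x.

(** The exponent j of the largest variable is kept apart so that differentiation can lower it,
    possibly to 0. *)
Definition comp_sum_head m n j x : R :=
  \sum_(t : m.-tuple 'I_r.+1 | sumn (map val t) == n)
    Aser (j :: rev [seq i.+1 | i <- map val t]) x.

Lemma comp_sum0 n x : comp_sum 0 n x = (n == 0%N)%:R.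
Proof.
rewrite /comp_sum; case: n => [|n].
  by rewrite (big_pred1 [tuple]) ?Aser_nil // => t; rewrite tuple0.
by rewrite big_pred0 // => t; rewrite tuple0.
Qed.

Lemma big_tuple_rcons_sumn (m n : nat) (F : seq 'I_r.+1 -> R) : (n <= r)%N ->
  \sum_(t : m.+1.-tuple 'I_r.+1 | sumn (map val t) == n) F t =
  \sum_(h < n.+1) \sum_(t : m.-tuple 'I_r.+1 | sumn (map val t) == (n - h)%N)
    F (rcons t (inord h)).
Proof.
move=> le_nr; rewrite (@big_tuple_rcons _ _ _ (fun t => sumn (map val t) == n)).
rewrite (big_ord_widen r.+1 (fun h => \sum_(t : m.-tuple 'I_r.+1 |
  sumn (map val t) == (n - h)%N) F (rcons t (inord h)))) //.
rewrite [RHS]big_mkcond; apply: eq_bigr => h _; rewrite ltnS.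
case: leqP => lt_hn.
  apply: eq_big => [t|t _]; last by rewrite inord_val.
  by rewrite map_rcons sumn_rcons -{1}(subnK lt_hn) eqn_add2r.
apply: big_pred0 => t; rewrite map_rcons sumn_rcons; apply/eqP => e.
by move: lt_hn; rewrite -e ltnNge leq_addl.
Qed.

Lemma comp_sumS m n x : (n <= r)%N ->
  comp_sum m.+1 n x = \sum_(h < n.+1) comp_sum_head m (n - h) h.+1 x.
Proof.
move=> le_nr; rewrite /comp_sum (big_tuple_rcons_sumn _
  (fun t => Aser (rev [seq i.+1 | i <- map val t]) x)) //.
apply: eq_bigr => h _; apply: eq_bigr => t _.
by rewrite !map_rcons rev_rcons /= inordK // (leq_trans (ltn_ord h)).
Qed.

Lemma comp_sum_head0 m n x : `|x| < 1 ->
  (1 - x ^+ 2) * comp_sum_head m n 0 x = 2 * x * comp_sum m n x.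
Proof.
move=> x1; rewrite /comp_sum /comp_sum_head !mulr_sumr.
by apply: eq_bigr => t _; exact: Aser_head0.
Qed.

Lemma is_derive_comp_sum_head m n j x : x != 0 -> `|x| < 1 ->
  is_derive x 1 (comp_sum_head m n j.+1) (x^-1 * comp_sum_head m n j x).
Proof.
move=> x0 x1; rewrite /comp_sum_head mulr_sumr.
by apply: is_derive_bigsum => t _; exact: is_derive_AserS.
Qed.

Lemma cvg_comp_sum_head m n j b :
  Aser (nseq b 1%N) (cayley z) * comp_sum_head m n j z @[z --> 0^'+] --> (0 : R).
Proof.
rewrite /comp_sum_head; under eq_cvg do rewrite mulr_sumr.
by apply: cvg_bigsum0 => t _; under eq_cvg do rewrite mulrC; exact: cvg_Aser_mul_ones.
Qed.

(* The derivatives of the first factors and of the second factors telescope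
   against each other, except where the last part of the composition vanishes. *)
Lemma is_derive_comp_sum_ones m z : 0 < z -> z < 1 ->
  is_derive z 1
    (fun y => \sum_(b < r.+1) Aser (nseq b 1%N) (cayley y) * comp_sum m.+1 (r - b) y)
    (2 / (1 - z ^+ 2) *
      \sum_(b < r.+1) Aser (nseq b 1%N) (cayley z) * comp_sum m (r - b) z).
Proof.
move=> z0 z1; have z_neq0 := lt0r_neq0 z0; have nz1 := norm_lt1 z0 z1.
pose g b := Aser (nseq b 1%N) (cayley z).
pose dg b := if b is b'.+1 then - z^-1 * g b' else 0.
have hg b : is_derive z 1 (fun y => Aser (nseq b 1%N) (cayley y)) (dg b).
  by case: b => [|b]; [exact: is_derive_Aser_nil_cayley|exact: is_derive_Aser1_cayley].
pose dc n := z^-1 * \sum_(h < n.+1) comp_sum_head m (n - h) h z.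
have hc n : (n <= r)%N -> is_derive z 1 (comp_sum m.+1 n) (dc n).
  move=> le_nr; have -> : comp_sum m.+1 n =
      (fun y => \sum_(h < n.+1) comp_sum_head m (n - h) h.+1 y).
    by apply/funext => y; exact: comp_sumS.
  rewrite /dc mulr_sumr; apply: is_derive_bigsum => h _.
  exact: is_derive_comp_sum_head.
have hd (b : 'I_r.+1) := is_derive_prod (hg b) (hc _ (leq_subr b r)).
apply: is_derive_eq (is_derive_bigsum _ (fun b _ => hd b)) _.
have dcS n : (n.+1 <= r)%N ->
    dc n.+1 = z^-1 * (comp_sum_head m n.+1 0 z + comp_sum m.+1 n z).
  move=> lt_nr; rewrite /dc big_ord_recl subn0 (@comp_sumS m n z (ltnW lt_nr)).
  by congr (_ * _); congr (_ + _); apply: eq_bigr.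
have head0 n : z^-1 * comp_sum_head m n 0 z = 2 / (1 - z ^+ 2) * comp_sum m n z.
  have z2 : 1 - z ^+ 2 != 0 by rewrite subr_eq0 gt_eqF // expr_lt1 // ltW.
  apply: (mulfI z2); rewrite mulrCA comp_sum_head0 //.
  by field; rewrite z_neq0 z2.
rewrite big_split /= big_ord_recl mul0r add0r [X in _ + X]big_ord_recr subnn /=.
rewrite addrA -big_split /= mulr_sumr [RHS]big_ord_recr subnn /=; congr (_ + _).
  apply: eq_bigr => b _; rewrite /bump /= add1n -(subnSK (ltn_ord b)).
  rewrite dcS; last by rewrite subnSK ?leq_subr.
  rewrite [z^-1 * (_ + _)]mulrDr head0 /g; ring.
by rewrite /dc big_ord1 subnn head0 mulrCA.
Qed.

End Compositions.

(** * Induction on k *)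

Section Induction.
Variables (R : realType) (p : nat).
Local Open Scope classical_set_scope.
Local Open Scope ring_scope.
Implicit Types (z : R) (m : nat).

(** The right-hand side of the theorem for r = p + 1 and k = m + 1, multiplied by (-1)^m; b is the
    last part a_k. *)
Definition rhs_sum m z : R :=
  \sum_(j < m) (-1) ^+ j.+1 * T R (rcons (nseq j 1%N) p.+2) *
     Aser (nseq (m - j.+1) 1%N) z
  + \sum_(b < p.+2) Aser (nseq b 1%N) (cayley z) * comp_sum p.+1 m (p.+1 - b) z.

Lemma is_derive_rhs_sum m z : 0 < z -> z < 1 ->
  is_derive z 1 (rhs_sum m.+1) (2 / (1 - z ^+ 2) * rhs_sum m z).
Proof.
move=> z0 z1; have z_neq0 := lt0r_neq0 z0; have nz1 := norm_lt1 z0 z1.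
pose c j : R := (-1) ^+ j.+1 * T R (rcons (nseq j 1%N) p.+2).
pose dl n := if n is n'.+1 then 2 / (1 - z ^+ 2) * Aser (nseq n' 1%N) z else 0.
have hl n : is_derive z 1 (Aser (nseq n 1%N)) (dl n).
  by case: n => [|n]; [exact: is_derive_Aser_nil|exact: is_derive_Aser1].
have hc (j : 'I_m.+1) :=
  is_derive_prod (is_derive_cst (c j : R^o) z 1) (hl (m.+1 - j.+1)%N).
have h := is_deriveD (is_derive_bigsum (index_enum 'I_m.+1) (fun j (_ : true) => hc j))
  (is_derive_comp_sum_ones p.+1 m z0 z1).
apply: is_derive_eq h _.
rewrite /rhs_sum mulrDr; congr (_ + _).
rewrite big_ord_recr /= subnn mulr0 mul0r !addr0 mulr_sumr.
apply: eq_bigr => j _; rewrite mul0r add0r subSS -(subnSK (ltn_ord j)) /= /c; ring.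
Qed.

(** Only at j = m is the index of the function of z empty; every other term, including all those of
    the second sum, tends to 0. *)
Lemma cvg_rhs_sum m :
  rhs_sum m.+1 z @[z --> 0^'+] --> (-1) ^+ m.+1 * T R (rcons (nseq m 1%N) p.+2).
Proof.
rewrite -[X in _ --> X]addr0; apply: cvgD.
  rewrite -[X in _ --> X]add0r.
  under eq_cvg do rewrite big_ord_recr /= subnn Aser_nil mulr1.
  apply: cvgD; last exact: cvg_cst.
  apply: cvg_bigsum0 => j _.
  rewrite -[X in _ --> X](mulr0 ((-1) ^+ j.+1 * T R (rcons (nseq j 1%N) p.+2))).
  apply: cvgM; first exact: cvg_cst.
  by rewrite subSS -(subnSK (ltn_ord j)); exact: cvg_Aser0.
apply: cvg_bigsum0 => b _.
under eq_cvg do rewrite comp_sumS ?leq_subr // mulr_sumr.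
by apply: cvg_bigsum0 => h _; exact: cvg_comp_sum_head.
Qed.

Lemma Aser_cayley_rhs_sum m z : 0 < z -> z < 1 ->
  (-1) ^+ m * Aser (m.+1 :: nseq p 1%N) (cayley z) = rhs_sum m z.
Proof.
elim: m z => [|m IHm] z z0 z1.
  (* With no part besides the last, only b = p + 1 contributes. *)
  rewrite /rhs_sum big_ord0 add0r expr0 mul1r big_ord_recr /= subnn comp_sum0 mulr1.
  rewrite big1 ?add0r // => b _; rewrite comp_sum0 subn_eq0 leqNgt ltnS.
  by rewrite -ltnS ltn_ord mulr0.
apply/eqP; rewrite -subr_eq0; apply/eqP.
pose f y := (-1) ^+ m.+1 * Aser (m.+2 :: nseq p 1%N) (cayley y) - rhs_sum m.+1 y.
apply: (@derive0_limit01 _ f 0) => // [y y0 y1|].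
  have h := is_derive_prod (is_derive_cst ((-1) ^+ m.+1 : R^o) y 1)
    (is_derive_AserSS_cayley m.+1 (nseq p 1%N) y0 y1).
  apply: is_derive_eq (is_deriveB h (is_derive_rhs_sum m y0 y1)) _.
  rewrite -IHm // /= exprS; ring.
rewrite -[X in _ --> X](subrr ((-1) ^+ m.+1 * T R (rcons (nseq m 1%N) p.+2))).
apply: cvgB; last exact: cvg_rhs_sum.
(* The left side tends to a multiple of T({1}_p, m+2), the right side to the same multiple of
   T({1}_m, p+2). *)
by apply: cvgM; [exact: cvg_cst|rewrite T_duality; exact: cvg_Aser_T].
Qed.

End Induction.

Theorem theorem2p12 (R : realType) (r k : nat) (z : R)
    (r_gt0 : (0 < r)%N) (k_gt0 : (0 < k)%N) (z_gt0 : 0 < z) (z_lt1 : z < 1) :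
  A (rcons (nseq r.-1 1%N) k) ((1 - z) / (1 + z)) =
  \sum_(0 <= j < k.-1)
     (-1) ^+ (k - j) * T R (rcons (nseq j 1%N) r.+1)
       * A (nseq (k - 2 - j) 1%N) z
  + (-1) ^+ k.-1 *
    \sum_(a : k.-tuple 'I_r.+1 | (\sum_(i < k) val (tnth a i))%N == r)
       A (nseq (last 0%N (map val a)) 1%N) ((1 - z) / (1 + z))
         * A [seq x.+1 | x <- take k.-1 (map val a)] z.
Proof.
case: r r_gt0 => // p _; case: k k_gt0 => // m _.
have w0 := cayley_gt0 z_gt0 z_lt1; have w1 := cayley_lt1 z_gt0 z_lt1.
rewrite -/(cayley z) A_Aser // rev_rcons rev_nseq /=.
have -> : Aser (m.+1 :: nseq p 1%N) (cayley z) = (-1) ^+ m * rhs_sum p m z.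
  by rewrite -Aser_cayley_rhs_sum // mulrA -exprD addnn -signr_odd odd_double mul1r.
rewrite /rhs_sum mulrDr; congr (_ + _).
  rewrite big_mkord mulr_sumr; apply: eq_bigr => j _.
  have lt_jm := ltn_ord j.
  rewrite A_Aser // rev_nseq (_ : m.+1 - 2 - j = m - j.+1)%N; last by lia.
  rewrite !mulrA -exprD; congr (_ * _ * _).
  rewrite -signr_odd -[RHS]signr_odd; congr (_ ^+ nat_of_bool _); lia.
congr (_ * _).
(* The summand is put as a function of the bare sequence, so that [big_tuple_rcons_sumn] can split
   off a_k. *)
pose F (t : seq 'I_p.+2) := A (nseq (last 0%N (map val t)) 1%N) (cayley z) *
  A [seq x.+1 | x <- take m (map val t)] z.
transitivity (\sum_(a : m.+1.-tuple 'I_p.+2 | sumn (map val a) == p.+1) F a).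
  rewrite big_tuple_rcons_sumn //; apply: eq_bigr => b _.
  rewrite /comp_sum mulr_sumr; apply: eq_bigr => t _.
  rewrite /F map_rcons last_rcons /= inordK //.
  rewrite -cats1 take_size_cat ?size_map ?size_tuple //.
  by rewrite !A_Aser // rev_nseq -map_rev.
apply: eq_bigl => a; congr (_ == _).
by rewrite sumnE big_map big_tuple.
Qed.
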